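(* Let $q\ge1$ and $k\ge0$ be integers, and let $G$ be a simple connected graph with $n$ nodes and $m$ edges. Let $\tilde{\mathcal K}_{q,k}$ denote the multiplicative degree-Kirchhoff index of the iterated $q$-subdivision graph $S_{q,k}(G)$. Then: (i) if $q=2$, $$\tilde{\mathcal{K}}_{2,k}=16^{k}\tilde{\mathcal{K}}_{2,0}+\frac{2m^2k16^{k}}{3}+\Big(\frac{4m^2+3m}{3}-2mn\Big)\frac{16^{k}-4^{k}}{3};$$ (ii) if $q\neq2$, $$\tilde{\mathcal{K}}_{q,k}=(8q)^k\tilde{\mathcal{K}}_{q,0}+\frac{2m^2q(q-1)}{(q-2)(2q-1)}\Big[(2q)^{2k}-(8q)^k\Big]+\Big(\frac{2m^2q+2mq-m}{2q-1}-2mn\Big)\frac{(8q)^k-(2q)^k}{3}.$$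
   Context: The $q$-subdivision graph $S_q(G)$ is obtained from $G$ by replacing each edge $uv$ with $q$ disjoint paths of length $2$: $ux_1v,\ldots,ux_qv$. The iterated $q$-subdivision graphs are $S_{q,0}(G)=G$ and $S_{q,k}(G)=S_q(S_{q,k-1}(G))$ for $k\ge1$. For a connected graph $G$ with node degrees $d_i$, the resistance distance $r_{ij}$ is the effective resistance between $i$ and $j$ when each edge is replaced by a unit resistor. The multiplicative degree-Kirchhoff index is $\tilde{\mathcal K}(G)=\sum_{\{i,j\}\subseteq V(G)}d_id_jr_{ij}$, the sum over unordered pairs of nodes. *)

(* Defs.v *)
(* Mathematical Components; mathcomp-classical only for [xget]. *)
From HB Require Import structures.
From mathcomp Require Import all_boot all_order all_algebra.
From mathcomp Require Import boolp classical_sets.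

Set Implicit Arguments.
Unset Strict Implicit.
Unset Printing Implicit Defensive.

Import Order.TTheory GRing.Theory Num.Theory.
Local Open Scope ring_scope.

(* A record rather than a relation on a fixed finType, because subdividing
   changes the type of nodes. *)
Record sgraph := SGraph {
  node :> finType;
  adj : rel node;
  adj_sym : symmetric adj;
  adj_irr : irreflexive adj
}.

Arguments adj {s}.

Definition edges (G : sgraph) : {set {set G}} :=
  [set E : {set G} | [exists u : G, exists v : G, adj u v && (E == [set u; v])]].

Definition degree (G : sgraph) (x : G) : nat := #|[set y : G | adj x y]|.

Definition connected_graph (G : sgraph) : Prop :=
  (0 < #|G|)%N /\ forall x y : G, connect adj x y.

Section Subdivision.
Variables (q : nat) (G : sgraph).

(* [inr (E, l)] is the middle node x_l of the l-th path replacing the edge E;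
   its only neighbours are the two endpoints of E. *)
Definition subdiv_node : finType := (G + {E | E \in edges G} * 'I_q)%type.

Definition subdiv_adj (a b : subdiv_node) : bool :=
  match a, b with
  | inl u, inr (E, _) => u \in val E
  | inr (E, _), inl u => u \in val E
  | _, _ => false
  end.

Lemma subdiv_adj_sym : symmetric subdiv_adj.
Proof. by move=> [u|[E l]] [v|[F h]]. Qed.

Lemma subdiv_adj_irr : irreflexive subdiv_adj.
Proof. by move=> [u|[E l]]. Qed.

Definition subdivision : sgraph := SGraph subdiv_adj_sym subdiv_adj_irr.

End Subdivision.

Definition iter_subdivision (q k : nat) (G : sgraph) : sgraph :=
  iter k (subdivision q) G.

Section Kirchhoff.
Variables (R : realFieldType) (G : sgraph).

(* Node potentials when a unit current enters at i and leaves at j: by Ohm's law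
   a unit resistor on xy carries the current v x - v y from x to y, and by
   Kirchhoff's current law the net current leaving x through the edges is the
   external current injected at x. *)
Definition unit_current_potential (i j : G) (v : G -> R) : Prop :=
  forall x : G, \sum_(y : G | adj x y) (v x - v y) = (x == i)%:R - (x == j)%:R.

(* On a connected graph the potential exists and is unique up to an additive
   constant, so the set below is a singleton; the default value 0 of [xget] is
   relevant only to nodes in different components. *)
Definition resistance (i j : G) : R :=
  xget 0 [set r | exists2 v, unit_current_potential i j v & r = v i - v j]%classic.

(* Each unordered pair of distinct nodes is counted once, through the
   enumeration of the nodes; pairs with i = j would contribute 0. *)
Definition mult_degree_kirchhoff : R :=
  \sum_(i : G) \sum_(j : G | (enum_rank i < enum_rank j)%N)
    (degree i)%:R * (degree j)%:R * resistance i j.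

End Kirchhoff.

Arguments resistance R {G} i j.

(* Main.v *)
Require Import Defs.
From HB Require Import structures.
From mathcomp Require Import all_boot all_order all_algebra.
From mathcomp Require Import classical_sets ring lra.

Set Implicit Arguments.
Unset Strict Implicit.
Unset Printing Implicit Defensive.

Import Order.TTheory GRing.Theory Num.Theory.
Local Open Scope ring_scope.

(** Let L be the Laplacian of a graph G with n nodes and m edges. A Green
    kernel is a function g such that L (g z) = delta_z - rho for every node z,
    with rho independent of z. Then g i - g j is a unit current potential from
    i to j, so the resistances are r_ij = g_ii - g_ij - g_ji + g_jj
    ([green_resistance]), and summing against the degrees gives
<<
      K(G) = 2 m A - B,   A = sum_x d_x g_xx,   B = sum_(x,y) d_x d_y g_xy
>>
    ([green_kirchhoff]).

    Subdividing acts simply on these quantities. A potential of S_q(G) without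
    source at a middle node takes there the mean of the values at the two
    endpoints of the edge. Hence a Green kernel of S_q(G) is obtained from g by
    extending it to middle nodes by means in both variables, multiplying by 2/q
    (an edge becomes q parallel paths of resistance 2) and adding 1/2 at each
    pair (b, b) with b a middle node ([subdivision_green_kernel]).
    Extending by means multiplies a degree-weighted sum by 2q
    ([sum_degree_midpoint_ext]), so
<<
      B' = 8 q B + 2 q m.
>>
    The diagonal sum only involves g_xx and the values g_xy along edges, which
    Foster's identity sum_(x ~ y) (g_xx - g_xy) = n - 1 ([foster]) reduces to
<<
      A' = 4 A - n + 1 + q m.
>>
    With m' = 2 q m this yields the recurrence ([kirchhoff_subdivision])
<<
      K(S_q(G)) = 8 q K(G) + 4 q^2 m^2 + 2 q m - 4 q m n.
>>
    Since m_k = (2q)^k m and n_k = n + q m ((2q)^k - 1) / (2q - 1), both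
    formulas follow by induction on k; q = 2 is the resonant case 8q = (2q)^2.

    A Green kernel exists on a connected graph because the Laplacian grounded
    at one node is injective ([green_kernel_exists]); it is then carried along
    the iterated subdivisions. *)

(** * Sums over nodes, edges and ordered pairs of adjacent nodes *)

Section Incidence.
Variables (R : realFieldType) (G : sgraph).
Implicit Types (f g : G -> R) (F : {set G} -> R).

Lemma sum_darts_swap (F : G -> G -> R) :
  \sum_x \sum_(y | adj x y) F x y = \sum_x \sum_(y | adj x y) F y x.
Proof.
rewrite (exchange_big_dep predT) //=; apply: eq_bigr => y _.
by apply: eq_bigl => x; rewrite adj_sym.
Qed.

Lemma degreeE (x : G) : (degree x)%:R = \sum_(y | adj x y) (1 : R).
Proof. by rewrite sumr_const; congr _%:R; apply: eq_card => y; rewrite !inE. Qed.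

Lemma sum_darts_fst f :
  \sum_x \sum_(y | adj x y) f x = \sum_x (degree x)%:R * f x.
Proof.
apply: eq_bigr => x _; rewrite degreeE mulr_suml.
by apply: eq_bigr => y _; rewrite mul1r.
Qed.

Lemma adj_neq (x y : G) : adj x y -> x != y.
Proof. by apply: contraTneq => ->; rewrite adj_irr. Qed.

Lemma sum_endpoints (x y : G) f : adj x y ->
  \sum_(z in [set x; y]) f z = f x + f y.
Proof. by move=> /adj_neq xy; rewrite big_setU1 ?inE //= big_set1. Qed.

(** The edges at x are the sets {x, y} for y adjacent to x, and distinct
    neighbours give distinct edges. *)
Lemma sum_edges_at (x : G) F :
  \sum_(E in edges G | x \in E) F E = \sum_(y | adj x y) F [set x; y].
Proof.
pose N := [set y | adj x y].
have inj : {in N &, injective (fun y => [set x; y])}.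
  move=> y z; rewrite !inE => /adj_neq xy /adj_neq xz /setP /(_ y).
  by rewrite !inE eqxx orbT eq_sym (negPf xy) /= => /esym/eqP.
have -> : \sum_(y | adj x y) F [set x; y] = \sum_(y in N) F [set x; y].
  by apply: eq_bigl => y; rewrite inE.
rewrite -(big_imset _ inj); apply: eq_bigl => E.
apply/andP/imsetP => [[]|[y]]; rewrite !inE.
  case/existsP=> u /existsP[v /andP[uv /eqP->]]; rewrite !inE.
  case/orP=> /eqP xE; first by exists v; rewrite ?inE ?xE.
  by exists u; rewrite ?inE xE 1?adj_sym // finset.setUC.
move=> xy ->; rewrite !inE eqxx; split=> //.
by apply/existsP; exists x; apply/existsP; exists y; rewrite xy eqxx.
Qed.

Lemma sum_edges_endpoints (F : {set G} -> G -> R) :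
  \sum_(E in edges G) \sum_(x in E) F E x =
  \sum_x \sum_(y | adj x y) F [set x; y] x.
Proof.
rewrite (exchange_big_dep predT) //=; apply: eq_bigr => x _.
exact: (sum_edges_at x (F^~ x)).
Qed.

Lemma card_edge E : E \in edges G -> #|E| = 2%N.
Proof.
rewrite inE => /existsP[u /existsP[v /andP[/adj_neq uv /eqP->]]].
by rewrite cards2 uv.
Qed.

Lemma handshake :
  \sum_(x : G) (degree x)%:R = 2 * #|edges G|%:R :> R.
Proof.
transitivity (\sum_(E in edges G) \sum_(x in E) (1 : R)).
  rewrite (sum_edges_endpoints (fun _ _ => 1)) sum_darts_fst.
  by apply: eq_bigr => x _; rewrite mulr1.
under eq_bigr => E /card_edge EG do rewrite sumr_const EG.
by rewrite sumr_const mulr_natr.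
Qed.

End Incidence.

(** * Green kernels, resistances and the Kirchhoff index *)

Section GreenKernel.
Variables (R : realFieldType) (G : sgraph).
Implicit Types (f : G -> R) (g : G -> G -> R).

Definition laplacian f (x : G) : R := \sum_(y | adj x y) (f x - f y).

(** The background density [rho] absorbs the unit current injected at [z]. Its
    shape varies: grounding a node gives a point mass, which then stays on the
    old nodes under subdivision. *)
Definition green_kernel g (rho : G -> R) : Prop :=
  forall z x, laplacian (g z) x = (x == z)%:R - rho x.

Lemma laplacian_self_adjoint f h :
  \sum_x f x * laplacian h x = \sum_x laplacian f x * h x.
Proof.
transitivity (\sum_x \sum_(y | adj x y) (f x * h x - f x * h y)).
  by apply: eq_bigr => x _; rewrite mulr_sumr; apply: eq_bigr => y _; ring.
transitivity (\sum_x \sum_(y | adj x y) (f x * h x - f y * h x)); last first.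
  by apply: eq_bigr => x _; rewrite mulr_suml; apply: eq_bigr => y _; ring.
under eq_bigr do rewrite sumrB; under [RHS]eq_bigr do rewrite sumrB.
by rewrite !sumrB [X in _ - X]sum_darts_swap.
Qed.

Lemma sum_laplacian f : \sum_x laplacian f x = 0.
Proof.
have := laplacian_self_adjoint f (fun=> 1).
under eq_bigr do [rewrite /laplacian; under eq_bigr do rewrite subrr];
  under [X in _ = X -> _]eq_bigr do rewrite mulr1.
by move=> <-; apply: big1 => x _; rewrite big1 ?mulr0.
Qed.

Lemma laplacianB f h x :
  laplacian (fun y => f y - h y) x = laplacian f x - laplacian h x.
Proof. by rewrite -sumrB; apply: eq_bigr => y _; ring. Qed.

Lemma sum_delta (z : G) f : \sum_x (x == z)%:R * f x = f z.
Proof.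
rewrite (bigD1 z) //= eqxx mul1r big1 ?addr0 // => x /negPf->.
by rewrite mul0r.
Qed.

(** The difference g i - g j is a unit current potential since rho cancels.
    It determines the resistance because, by self-adjointness, a harmonic
    function pairs to 0 with the Laplacian of g i - g j, that is, with
    delta_i - delta_j, and so takes the same value at i and j. *)
Lemma green_resistance g rho (i j : G) : green_kernel g rho ->
  resistance R i j = g i i - g i j - g j i + g j j.
Proof.
move=> gP; pose w x := g i x - g j x.
have wP : unit_current_potential i j w.
  move=> x; have := laplacianB (g i) (g j) x.
  by rewrite !gP => -[]; rewrite /laplacian /w => ->; ring.
have -> : g i i - g i j - g j i + g j j = w i - w j by rewrite /w; ring.
apply: xget_unique => [|_ [v vP ->]]; first by exists w.
(* w is itself the test potential against which v - w is paired *)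
have := laplacian_self_adjoint (fun x => v x - w x) w.
rewrite [RHS]big1 => [|x _]; last first.
  by rewrite laplacianB /laplacian vP wP subrr mul0r.
under eq_bigr => x _ do rewrite /laplacian wP mulrC mulrBl.
by rewrite sumrB !sum_delta => e; lra.
Qed.

(** A Laplacian has total sum 0, so rho removes exactly the injected unit. *)
Lemma green_mass g rho : (0 < #|G|)%N -> green_kernel g rho ->
  \sum_x rho x = 1.
Proof.
case/card_gt0P=> z _ gP; have := sum_laplacian (g z).
under eq_bigr do rewrite gP.
rewrite sumrB; have := sum_delta z (fun=> 1).
by under eq_bigr do rewrite mulr1; move=> -> /eqP; rewrite subr_eq0 => /eqP<-.
Qed.

(** The inner sum is L (g x) x = 1 - rho x, and rho has mass 1. The two
    orientations of an edge xy together contribute r_xy, so this is Foster's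
    theorem on the sum of the resistances over the edges. *)
Lemma foster g rho : (0 < #|G|)%N -> green_kernel g rho ->
  \sum_x \sum_(y | adj x y) (g x x - g x y) = #|G|%:R - 1.
Proof.
move=> G0 gP; under eq_bigr do rewrite -/(laplacian _ _) gP eqxx.
by rewrite sumrB (green_mass G0 gP) sumr_const.
Qed.

(** In the double sum of d_i d_j r_ij over ordered pairs, each of g_ii and g_jj
    decouples, one of the two degree sums being 2m by the handshake lemma. *)
Lemma green_kirchhoff g rho : green_kernel g rho ->
  mult_degree_kirchhoff R G =
    (2 * #|edges G|%:R) * (\sum_x (degree x)%:R * g x x)
    - \sum_x \sum_y (degree x)%:R * (degree y)%:R * g x y.
Proof.
move=> gP.
pose t (i j : G) : R := (degree i)%:R * (degree j)%:R * resistance R i j.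
have tE i j : t i j = (degree i)%:R * (degree j)%:R *
   (g i i - g i j - g j i + g j j) by rewrite /t (green_resistance _ _ gP).
have tC i j : t i j = t j i by rewrite !tE; ring.
have t0 i : t i i = 0 by rewrite tE; ring.
rewrite /mult_degree_kirchhoff -/t.
(* the diagonal vanishes and the rest splits into i < j and its mirror image *)
have two : \sum_i \sum_j t i j = 2 * mult_degree_kirchhoff R G.
  rewrite mulrDl !mul1r -[X in _ = _ + X]/(\sum_i \sum_(j | _) t i j).
  rewrite [X in _ = _ + X](exchange_big_dep predT) //= -big_split /=.
  apply: eq_bigr => i _.
  rewrite (bigID (fun j => enum_rank i < enum_rank j)%N) /=; congr (_ + _).
  rewrite (bigD1 i) ?ltnn //= t0 add0r; apply: eq_big => [j|j _]; last exact: tC.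
  by rewrite -leqNgt ltn_neqAle andbC (inj_eq val_inj) (inj_eq enum_rank_inj).
have sumE : \sum_i \sum_j t i j =
    2 * ((2 * #|edges G|%:R) * (\sum_x (degree x)%:R * g x x)
    - \sum_x \sum_y (degree x)%:R * (degree y)%:R * g x y).
  have dg : \sum_i \sum_(j : G) (degree i)%:R * (degree j)%:R * g i i =
      2 * #|edges G|%:R * \sum_x (degree x)%:R * g x x.
    rewrite -(handshake R G) mulr_suml exchange_big /=.
    apply: eq_bigr => j _.
    by rewrite mulr_sumr; apply: eq_bigr => i _; ring.
  transitivity (2 * \sum_i \sum_(j : G) ((degree i)%:R * (degree j)%:R * g i i
                  - (degree i)%:R * (degree j)%:R * g i j)).
    rewrite mulrDl !mul1r [X in _ = _ + X]exchange_big -big_split /=.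
    apply: eq_bigr => i _; rewrite -big_split; apply: eq_bigr => j _ /=.
    by rewrite tE; ring.
  by under eq_bigr do rewrite sumrB; rewrite sumrB dg.
by apply: (@mulfI _ 2); rewrite ?pnatr_eq0 // -two sumE.
Qed.

End GreenKernel.

(** * Existence of Green kernels on connected graphs *)

Section Existence.
Variables (R : realFieldType) (G : sgraph).

(** The Dirichlet energy of f equals 2 <f, L f>, so it vanishes, and each of its
    terms (f x - f y)^2 with it. *)
Lemma harmonic_constant (f : G -> R) :
  (forall x, laplacian f x = 0) -> forall x y, connect adj x y -> f x = f y.
Proof.
move=> f0.
have energy : \sum_x \sum_(y | adj x y) (f x - f y) ^+ 2 = 0.
  transitivity (2 * \sum_x f x * laplacian f x); last first.
    by rewrite big1 ?mulr0 // => x _; rewrite f0 mulr0.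
  under [in RHS]eq_bigr do rewrite mulr_sumr.
  rewrite mulrDl !mul1r [X in _ = _ + X]sum_darts_swap -big_split /=.
  apply: eq_bigr => x _; rewrite -big_split; apply: eq_bigr => y _ /=; ring.
have flat x y : adj x y -> f x = f y.
  move=> xy; apply/eqP; rewrite -subr_eq0 -sqrf_eq0; apply/eqP.
  have ge0 x' : 0 <= \sum_(y | adj x' y) (f x' - f y) ^+ 2.
    by apply: sumr_ge0 => y' _; apply: sqr_ge0.
  have row0 := psumr_eq0P (fun x' _ => ge0 x') energy (i := x) isT.
  exact: (psumr_eq0P (fun y' _ => sqr_ge0 (f x - f y')) row0 xy).
move=> x y /connectP[p]; elim: p x => [x _ -> //|z p IH x /= /andP[xz pz] yE].
by rewrite (flat _ _ xz); apply: IH.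
Qed.

(** Adding a unit resistor from [o] to a ground at potential 0 removes the
    constants from the kernel. *)
Definition grounded_laplacian (o : G) (f : {ffun G -> R^o}) : {ffun G -> R^o} :=
  [ffun x => laplacian f x + (x == o)%:R * f o].

Lemma grounded_laplacian_linear o : linear (grounded_laplacian o).
Proof.
move=> a f h; apply/ffunP => x; rewrite !ffunE scalerDr addrACA.
congr (_ + _); last by rewrite /GRing.scale /=; ring.
rewrite scaler_sumr -big_split; apply: eq_bigr => y _.
by rewrite !ffunE /GRing.scale /=; ring.
Qed.

HB.instance Definition _ o := GRing.isLinear.Build R {ffun G -> R^o}
  {ffun G -> R^o} _ (grounded_laplacian o) (grounded_laplacian_linear o).

(** The total sum of the grounded Laplacian T f is f o. So T f = 0 forces f o = 0,
    then f harmonic, then f = 0; being injective on a finite-dimensional space,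
    T is onto. For T (g z) = delta_z the same sum gives g z o = 1, which makes
    the current into the ground a unit point mass at o for every z. *)
Lemma green_kernel_exists : connected_graph G ->
  exists g rho, @green_kernel R G g rho.
Proof.
move=> [/card_gt0P[o _] conn].
pose T := linfun (grounded_laplacian o).
have Tmass f : \sum_x T f x = f o.
  rewrite lfunE; under eq_bigr do rewrite ffunE.
  by rewrite big_split /= sum_laplacian add0r (sum_delta o (fun=> f o)).
have T0 : lker T == 0%VS.
  rewrite -subv0; apply/subvP => f; rewrite memv_ker memv0 => /eqP Tf.
  have fo : f o = 0 by rewrite -Tmass Tf big1 // => x _; rewrite ffunE.
  apply/eqP/ffunP => x; rewrite ffunE -fo; apply: harmonic_constant => // y.
  have := congr1 (fun h : {ffun G -> R^o} => h y) Tf.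
  by rewrite lfunE !ffunE fo mulr0 addr0.
pose g z : {ffun G -> R^o} := (T^-1)%VF [ffun x => (x == z)%:R].
exists (fun z => g z), (fun x => (x == o)%:R) => z x.
have Tg : T (g z) = [ffun x => (x == z)%:R].
  by rewrite /g -[LHS]comp_lfunE lker0_compfV // id_lfunE.
have go : g z o = 1.
  rewrite -Tmass Tg -[RHS](sum_delta z (fun=> 1)).
  by apply: eq_bigr => y _; rewrite ffunE mulr1.
have := congr1 (fun h : {ffun G -> R^o} => h x) Tg.
by rewrite lfunE !ffunE go mulr1 => <-; rewrite addrK.
Qed.

End Existence.

(** * Transport of the Green kernel to the subdivision *)

Section Subdivide.
Variables (R : realFieldType) (q : nat) (G : sgraph).
Local Notation S := (subdivision q G).
Implicit Types (h : G -> R) (g : G -> G -> R) (F : S -> R).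

Lemma sum_subdivision F :
  \sum_a F a = \sum_x F (inl x)
             + \sum_(e : {E | E \in edges G}) \sum_(l < q) F (inr (e, l)).
Proof.
rewrite big_sumType /=; congr (_ + _).
by rewrite pair_big; apply: eq_bigr => -[].
Qed.

Lemma sum_adj_inl (x : G) F :
  \sum_(a | adj (inl x : S) a) F a =
  \sum_(e : {E | E \in edges G} | x \in val e) \sum_(l < q) F (inr (e, l)).
Proof.
rewrite big_sumType /= big_pred0_eq add0r pair_big.
by apply: eq_big => [[e l]|[]]//=; rewrite andbT.
Qed.

Lemma sum_adj_inr (e : {E | E \in edges G}) (l : 'I_q) F :
  \sum_(a | adj (inr (e, l) : S) a) F a = \sum_(x in val e) F (inl x).
Proof. by rewrite big_sumType /= [X in _ + X]big_pred0_eq addr0. Qed.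

Lemma degree_inl (x : G) : (degree (inl x : S))%:R = q%:R * (degree x)%:R :> R.
Proof.
rewrite degreeE sum_adj_inl -(big_sub_cond (mem (edges G)) (fun E => x \in E)
  (fun=> \sum_(l < q) 1)) /= (sum_edges_at x (fun=> \sum_(l < q) 1)).
rewrite degreeE mulr_sumr; apply: eq_bigr => y _.
by rewrite sumr_const card_ord mulr1.
Qed.

Lemma degree_inr e (l : 'I_q) : (degree (inr (e, l) : S))%:R = 2 :> R.
Proof. by rewrite degreeE sum_adj_inr sumr_const (card_edge (valP e)). Qed.

Lemma card_subdivision : #|S|%:R = #|G|%:R + q%:R * #|edges G|%:R :> R.
Proof.
rewrite card_sum card_prod card_sig card_ord natrD natrM mulrC.
by congr (_ + _ * _%:R); apply: eq_card => E; rewrite !inE.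
Qed.

(** A middle node without source has the mean potential of its two neighbours,
    so this is the extension of [h] that is harmonic at all middle nodes. *)
Definition midpoint_ext h (a : S) : R :=
  match a with
  | inl x => h x
  | inr (e, _) => (\sum_(x in val e) h x) / 2
  end.

Lemma sum_degree_subdivision F :
  \sum_a (degree a)%:R * F a = q%:R * \sum_x (degree x)%:R * F (inl x)
    + 2 * \sum_(e : {E | E \in edges G}) \sum_(l < q) F (inr (e, l)).
Proof.
rewrite sum_subdivision !mulr_sumr; congr (_ + _); apply: eq_bigr => x _.
  by rewrite degree_inl mulrA.
by rewrite mulr_sumr; apply: eq_bigr => l _; rewrite degree_inr.
Qed.

Lemma sum_middle (F : {set G} -> R) :
  \sum_(e : {E | E \in edges G}) \sum_(l < q) F (val e) =
  q%:R * \sum_(E in edges G) F E.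
Proof.
rewrite (big_sub (mem (edges G)) F) mulr_sumr; apply: eq_bigr => e _.
by rewrite sumr_const card_ord mulr_natl.
Qed.

(** The old nodes contribute q sum d_x h x. A middle node of degree 2 carries the
    sum of h over the endpoints of its edge, so the middle nodes together
    contribute the same amount. *)
Lemma sum_degree_midpoint_ext h :
  \sum_a (degree a)%:R * midpoint_ext h a = 2 * q%:R * \sum_x (degree x)%:R * h x.
Proof.
rewrite sum_degree_subdivision /=.
rewrite (sum_middle (fun E => (\sum_(x in E) h x) / 2)) -mulr_suml.
by rewrite (sum_edges_endpoints (fun=> h)) sum_darts_fst; field.
Qed.

Lemma card_edges_subdivision :
  #|edges S|%:R = 2 * q%:R * #|edges G|%:R :> R.
Proof.
apply: (@mulfI _ 2); rewrite ?pnatr_eq0 // -(handshake R S).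
transitivity (\sum_(a : S) (degree a)%:R * (1 : R)).
  by apply: eq_bigr => a _; rewrite mulr1.
rewrite sum_degree_subdivision (sum_middle (fun=> 1)) sumr_const.
under eq_bigr do rewrite mulr1.
by rewrite (handshake R G); ring.
Qed.

(** A unit current injected at a middle node splits evenly between two unit
    resistors, raising that node by 1/2 above the mean of its neighbours. *)
Definition midpoint_source (b a : S) : R :=
  match b with inl _ => 0 | inr _ => (a == b)%:R / 2 end.

Definition subdivision_green g (b a : S) : R :=
  2 / q%:R * midpoint_ext (fun x => midpoint_ext (g^~ x) b) a
  + midpoint_source b a.

(** Along each of the q paths of an edge xy the drop from x to the middle node is
    half of h x - h y. *)
Lemma laplacian_midpoint_ext_inl h (x : G) :
  laplacian (midpoint_ext h) (inl x : S) = q%:R / 2 * laplacian h x.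
Proof.
rewrite /laplacian sum_adj_inl.
rewrite -(big_sub_cond (mem (edges G)) (fun E => x \in E)
  (fun E => \sum_(l < q) (h x - (\sum_(y in E) h y) / 2))) /=.
rewrite (sum_edges_at x (fun E => \sum_(l < q) _)) mulr_sumr.
apply: eq_bigr => y xy; rewrite sumr_const card_ord -mulr_natl.
by rewrite sum_endpoints //; field.
Qed.

Lemma laplacian_midpoint_ext_inr h e (l : 'I_q) :
  laplacian (midpoint_ext h) (inr (e, l) : S) = 0.
Proof.
rewrite /laplacian sum_adj_inr sumrB sumr_const (card_edge (valP e)) /=.
by rewrite -mulr_natr; field.
Qed.

(** For a middle source b the two endpoints of its edge each lose 1/2: the half
    of the unit current that reaches them from b. The indicator (inl x == b)
    and the extended delta make the formula uniform in b: they cancel when b is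
    an old node. *)
Lemma laplacian_midpoint_source_inl b (x : G) :
  laplacian (midpoint_source b) (inl x : S) =
  (inl x == b)%:R - midpoint_ext (fun z => (x == z)%:R) b.
Proof.
case: b => [z|[e l]] /=.
  by rewrite /laplacian big1 ?subrr // => a _; rewrite subrr.
have delta (T : finType) (P : pred T) (z : T) :
    \sum_(y | P y) (y == z)%:R = (P z)%:R :> R.
  rewrite big_mkcond (bigD1 z) //= eqxx big1 => [|y /negPf->]; last by case: ifP.
  by rewrite addr0; case: (P z).
under [in RHS]eq_bigr do rewrite eq_sym.
rewrite (delta _ (mem (val e)) x).
transitivity (\sum_(a | adj (inl x : S) a) (a == inr (e, l))%:R * - (2^-1 : R)).
  by apply: eq_bigr => a _ /=; rewrite mul0r; ring.
by rewrite -mulr_suml (delta _ (adj (inl x : S)) (inr (e, l))) /=; ring.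
Qed.

Lemma laplacian_midpoint_source_inr b (a : {E | E \in edges G} * 'I_q) :
  laplacian (midpoint_source b) (inr a : S) = (inr a == b)%:R.
Proof.
case: b => [z|b] /=.
  by rewrite /laplacian big1 ?subrr // => c _; rewrite subrr.
case: a => e l; rewrite /laplacian sum_adj_inr /=.
rewrite mul0r subr0 sumr_const (card_edge (valP e)) -mulr_natr.
by field.
Qed.

(** At an old node x the extension contributes the values of
    delta - rho averaged over the endpoints of b, and the source term replaces
    this averaged delta by the true one. At a middle node only the source term
    survives, so the new density vanishes there. *)
Lemma subdivision_green_kernel g rho : (0 < q)%N -> green_kernel g rho ->
  green_kernel (subdivision_green g) (fun a => if a is inl x then rho x else 0).
Proof.
move=> q0 gP b a; have q_neq0 : q%:R != 0 :> R by rewrite pnatr_eq0 -lt0n.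
have lapD f1 f2 c : laplacian (fun a : S => c * f1 a + f2 a) a =
    c * laplacian f1 a + laplacian f2 a.
  by rewrite mulr_sumr -big_split; apply: eq_bigr => a' _ /=; ring.
rewrite lapD; case: a {lapD} => [x|[e l]]; last first.
  by rewrite laplacian_midpoint_ext_inr laplacian_midpoint_source_inr; ring.
rewrite laplacian_midpoint_ext_inl laplacian_midpoint_source_inl.
suff -> : laplacian (fun y => midpoint_ext (g^~ y) b) x =
    midpoint_ext (fun z => (x == z)%:R) b - rho x by field.
case: b => [z|[e l]] /=; first exact: gP.
transitivity ((\sum_(z in val e) laplacian (g z) x) / 2).
  rewrite /laplacian exchange_big /= [RHS]mulr_suml; apply: eq_bigr => y _.
  by rewrite sumrB mulrBl.
under [in LHS]eq_bigr => z _ do rewrite gP.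
by rewrite sumrB sumr_const (card_edge (valP e)) -mulr_natr; field.
Qed.

(** Each of the two extensions contributes a factor 2q, whence
    (2/q) (2q)^2 = 8q; every one of the qm middle nodes, of degree 2, adds
    2 * 2 * (1/2) from the source term. *)
Lemma sum_green_subdivision g : (0 < q)%N ->
  \sum_b \sum_a (degree b)%:R * (degree a)%:R * subdivision_green g b a =
  8 * q%:R * \sum_x \sum_y (degree x)%:R * (degree y)%:R * g x y
  + 2 * q%:R * #|edges G|%:R.
Proof.
move=> q0; have q_neq0 : q%:R != 0 :> R by rewrite pnatr_eq0 -lt0n.
have ext : \sum_b (degree b)%:R * \sum_a (degree a)%:R *
    midpoint_ext (fun x => midpoint_ext (g^~ x) b) a =
  (2 * q%:R) ^+ 2 * \sum_x \sum_y (degree x)%:R * (degree y)%:R * g x y.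
  have inner b : \sum_a (degree a)%:R *
      midpoint_ext (fun x => midpoint_ext (g^~ x) b) a =
      midpoint_ext (fun y => 2 * q%:R * \sum_x (degree x)%:R * g y x) b.
    rewrite sum_degree_midpoint_ext; case: b => [//|[e l]] /=.
    rewrite -mulr_sumr exchange_big /= -[RHS]mulrA; congr (_ * _).
    by rewrite [RHS]mulr_suml; apply: eq_bigr => x _; rewrite -mulr_sumr mulrA.
  under eq_bigr do rewrite inner.
  rewrite sum_degree_midpoint_ext !mulr_sumr; apply: eq_bigr => x _.
  by rewrite !mulr_sumr; apply: eq_bigr => y _; ring.
have src b : \sum_a (degree a)%:R * midpoint_source b a =
    if b is inl _ then 0 else 1.
  case: b => [z|[e l]] /=; first by rewrite big1 // => a _; rewrite mulr0.
  under eq_bigr do rewrite mulrCA.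
  by rewrite (sum_delta (inr (e, l) : S)) degree_inr; field.
transitivity (2 / q%:R * (\sum_b (degree b)%:R * \sum_a (degree a)%:R *
    midpoint_ext (fun x => midpoint_ext (g^~ x) b) a) +
  \sum_b (degree b)%:R * \sum_a (degree a)%:R * midpoint_source b a).
  rewrite mulr_sumr -big_split; apply: eq_bigr => b _ /=.
  rewrite !mulr_sumr -big_split; apply: eq_bigr => a _ /=.
  by rewrite /subdivision_green; ring.
rewrite ext.
under [\sum_b _ * \sum_a _ * midpoint_source _ _]eq_bigr do rewrite src.
rewrite sum_degree_subdivision (sum_middle (fun=> 1)) sumr_const.
by rewrite [\sum_x _ * 0]big1 => [|x _]; [field | rewrite mulr0].
Qed.

(** A middle node of the edge xy sees g_xx + g_xy + g_yx + g_yy, and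
    g_xx + g_xy = 2 g_xx - (g_xx - g_xy) turns the sum over the edges into
    2 A - (n - 1) by Foster's identity. *)
Lemma sum_green_diag_subdivision g rho : (0 < q)%N -> (0 < #|G|)%N ->
  green_kernel g rho ->
  \sum_a (degree a)%:R * subdivision_green g a a =
  4 * (\sum_x (degree x)%:R * g x x) - #|G|%:R + 1 + q%:R * #|edges G|%:R.
Proof.
move=> q0 G0 gP; have q_neq0 : q%:R != 0 :> R by rewrite pnatr_eq0 -lt0n.
have mid : \sum_(E in edges G) \sum_(x in E) \sum_(y in E) g x y =
    2 * (\sum_x (degree x)%:R * g x x) - #|G|%:R + 1.
  rewrite (sum_edges_endpoints (fun E x => \sum_(y in E) g x y)).
  transitivity (\sum_x \sum_(y | adj x y) (2 * g x x - (g x x - g x y))).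
    apply: eq_bigr => x _; apply: eq_bigr => y xy.
    by rewrite sum_endpoints //; ring.
  under eq_bigr do rewrite sumrB.
  rewrite sumrB (foster G0 gP) (sum_darts_fst (fun x => 2 * g x x)) mulr_sumr.
  by under eq_bigr do rewrite mulrCA; ring.
rewrite sum_degree_subdivision /subdivision_green /=.
under eq_bigr do rewrite addr0 mulrCA.
rewrite -mulr_sumr.
under [X in _ + 2 * X]eq_bigr do under eq_bigr do rewrite eqxx -mulr_suml.
rewrite (sum_middle (fun E =>
  2 / q%:R * ((\sum_(x in E) (\sum_(y in E) g y x)) / 2 / 2) + 1 / 2)).
rewrite big_split sumr_const /= -mulr_sumr -!mulr_suml -mulr_natr.
under [X in X / 2 / 2]eq_bigr do rewrite exchange_big.
by rewrite mid; field.
Qed.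

End Subdivide.

(** * Recurrence and iteration *)

Lemma kirchhoff_subdivision (R : realFieldType) q (G : sgraph)
    (g : G -> G -> R) rho :
  (0 < q)%N -> (0 < #|G|)%N -> green_kernel g rho ->
  mult_degree_kirchhoff R (subdivision q G) =
  8 * q%:R * mult_degree_kirchhoff R G
  + 4 * q%:R ^+ 2 * #|edges G|%:R ^+ 2 + 2 * q%:R * #|edges G|%:R
  - 4 * q%:R * #|edges G|%:R * #|G|%:R.
Proof.
move=> q0 G0 gP; rewrite (green_kirchhoff (subdivision_green_kernel q0 gP)).
rewrite (green_kirchhoff gP) card_edges_subdivision sum_green_subdivision //.
rewrite (sum_green_diag_subdivision q0 G0 gP); ring.
Qed.

Section Iteration.
Variables (R : realFieldType) (q : nat) (G : sgraph).
Local Notation S k := (iter_subdivision q k G).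

Lemma card_edges_iter k :
  #|edges (S k)|%:R = (2 * q%:R) ^+ k * #|edges G|%:R :> R.
Proof.
elim: k => [|k IH]; first by rewrite mul1r.
by rewrite card_edges_subdivision IH exprS; ring.
Qed.

(** Stated with the factor 2q - 1 cleared, so that the induction step needs no
    division. *)
Lemma card_iter k : (2 * q%:R - 1) * #|S k|%:R =
  (2 * q%:R - 1) * #|G|%:R + q%:R * #|edges G|%:R * ((2 * q%:R) ^+ k - 1) :> R.
Proof.
elim: k => [|k IH]; first by rewrite expr0; ring.
by rewrite card_subdivision mulrDr IH card_edges_iter exprS; ring.
Qed.

Lemma iter_nonempty k : (0 < #|G|)%N -> (0 < #|S k|)%N.
Proof.
move=> G0; elim: k => [//|k /card_gt0P[x _]].
by apply/card_gt0P; exists (inl x).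
Qed.

Lemma green_kernel_iter k : (0 < q)%N -> connected_graph G ->
  exists g rho, @green_kernel R (S k) g rho.
Proof.
move=> q0 conn; elim: k => [|k [g [rho gP]]]; first exact: green_kernel_exists.
by eexists; eexists; apply: subdivision_green_kernel gP.
Qed.

Lemma kirchhoff_iterS k : (0 < q)%N -> connected_graph G ->
  mult_degree_kirchhoff R (S k.+1) =
  8 * q%:R * mult_degree_kirchhoff R (S k)
  + 4 * q%:R ^+ 2 * ((2 * q%:R) ^+ k * #|edges G|%:R) ^+ 2
  + 2 * q%:R * ((2 * q%:R) ^+ k * #|edges G|%:R)
  - 4 * q%:R * ((2 * q%:R) ^+ k * #|edges G|%:R)
    * (#|G|%:R + q%:R * #|edges G|%:R * ((2 * q%:R) ^+ k - 1) / (2 * q%:R - 1)).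
Proof.
move=> q0 conn; have [g [rho gP]] := green_kernel_iter k q0 conn.
rewrite (kirchhoff_subdivision q0 (iter_nonempty k conn.1) gP) card_edges_iter.
have nz : 2 * q%:R - 1 != 0 :> R.
  by rewrite subr_eq0 -natrM (eqr_nat R _ 1) eq_sym; case: (q) q0 => // -[].
congr (_ - _ * _); apply: (mulfI nz); rewrite card_iter.
by field.
Qed.

End Iteration.

Theorem theorem7p2 (R : realFieldType) (q k : nat) (G : sgraph)
    (hq : (1 <= q)%N) (hG : connected_graph G) :
  let n : R := #|G|%:R in
  let m : R := #|edges G|%:R in
  let K (p l : nat) : R := mult_degree_kirchhoff R (iter_subdivision p l G) in
  (q = 2%N ->
    K 2%N k = 16 ^+ k * K 2%N 0%N + 2 * m ^+ 2 * k%:R * 16 ^+ k / 3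
      + ((4 * m ^+ 2 + 3 * m) / 3 - 2 * m * n) * ((16 ^+ k - 4 ^+ k) / 3))
  /\
  (q <> 2%N ->
    K q k = (8 * q%:R) ^+ k * K q 0%N
      + (2 * m ^+ 2 * q%:R * (q%:R - 1)) / ((q%:R - 2) * (2 * q%:R - 1))
          * ((2 * q%:R) ^+ (2 * k) - (8 * q%:R) ^+ k)
      + ((2 * m ^+ 2 * q%:R + 2 * m * q%:R - m) / (2 * q%:R - 1) - 2 * m * n)
          * (((8 * q%:R) ^+ k - (2 * q%:R) ^+ k) / 3)).
Proof.
move=> n m K; have KS p l : (0 < p)%N -> _ := fun p0 => kirchhoff_iterS R l p0 hG.
split=> [_|q2].
  (* (2q)^k = 4^k and (8q)^k = 16^k = (4^k)^2: only 4^k is kept as an atom *)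
  elim: k => [|k IH]; first by rewrite !expr0; field.
  rewrite [K _ k.+1]KS // -/(K _ _) IH -/n -/m.
  have -> : 2 * 2 = 4 :> R by ring.
  have -> : 16 ^+ k = (4 ^+ k) ^+ 2 :> R.
    by rewrite -exprM mulnC exprM; congr (_ ^+ k); ring.
  have E16 : 16 ^+ k.+1 = 16 * (4 ^+ k) ^+ 2 :> R.
    by rewrite exprS -exprM mulnC exprM; congr (_ * _ ^+ k); ring.
  by rewrite E16 (exprS 4) -[k.+1%:R]natr1; field.
have nz1 : 2 * q%:R - 1 != 0 :> R.
  by rewrite subr_eq0 -natrM (eqr_nat R _ 1) eq_sym; case: (q) hq => // -[].
(* q = 2 makes the particular solution proportional to (2q)^(2k) degenerate *)
have nz2 : q%:R - 2 != 0 :> R by rewrite subr_eq0 eqr_nat; apply/eqP.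
elim: k => [|k IH]; first by rewrite muln0 !expr0; field; rewrite nz1.
rewrite [K _ k.+1]KS // -/(K _ _) IH -/n -/m mulnC exprM (mulnC 2) exprM.
rewrite !(exprS _ k); field; rewrite nz1; exact: nz2.
Qed.
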